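(* For all integers $k,n\geqslant 0$, there is a bijection between the maximal chains in the poset $\Sigma^k_n C^n_1$ and the words $w$ of length $(k+1)n$ over an alphabet $\{a_1,\dots,a_n\}$ of $n$ distinct letters such that each letter occurs exactly $k+1$ times in $w$, and for each prefix $z$ of $w$ and each $i$, either $a_i$ does not occur in $z$, or for each $j>i$ the letter $a_i$ occurs in $z$ at least as many times as $a_j$.
   Context: For $r\geqslant 0$, $C_r$ is the chain $\{0<1<\dots<r\}$ and $C_r^n$ its $n$-th cartesian power with componentwise order. Stacking (lax sum): given a sequence of posets $M_0,M_1,\dots$ with monotone maps $f_j\colon M_j\to M_{j+1}$, the poset $\Sigma_nM_n$ has elements the pairs $(x,j)$ with $0\leqslant j\leqslant n$, $x\in M_j$, ordered by $(x,j)\leqslant(y,k)$ iff $j\leqslant k$ and $(f_{k-1}\circ\dots\circ f_j)(x)\leqslant y$ in $M_k$ (identity composite when $j=k$). The maps $(x,j)\mapsto(x,j)$ from $\Sigma_nM_n$ to $\Sigma_{n+1}M_{n+1}$ make $(\Sigma_nM_n)_n$ a sequence of the same kind. Iterated stacking: $\Sigma^0_nM_n=M_n$ and $\Sigma^{k}_nM_n$ is the stacking of $(\Sigma^{k-1}_nM_n)_n$. $\Sigma^k_nC^n_1$ is the $k$-iterated stacking of $C^0_1\to C^1_1\to\dots$ with maps $(x_1,\dots,x_i)\mapsto(0,x_1,\dots,x_i)$. *)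

(* Defs.v *)
From HB Require Import structures.
From mathcomp Require Import all_boot all_order.

Set Implicit Arguments.
Unset Strict Implicit.
Unset Printing Implicit Defensive.

Import Order.TTheory.

Record posetSeq (d : Order.disp_t) := PosetSeq {
  pseq_obj :> nat -> finPOrderType d;
  pseq_map : forall n, pseq_obj n -> pseq_obj n.+1;
  pseq_mono : forall n, {homo @pseq_map n : x y / (x <= y)%O} }.

Arguments pseq_map {d} M {n} x : rename.

Section Stacking.

Variables (d : Order.disp_t) (M : posetSeq d).

Fixpoint pseq_shift j m : M j -> M (m + j) :=
  if m is m'.+1 then fun x => pseq_map M (pseq_shift m' x) else id.

(* The composite f_(k-1) o ... o f_j. *)
Definition pseq_comp j k (le_jk : j <= k) (x : M j) : M k :=
  ecast i (M i) (subnK le_jk) (pseq_shift (k - j) x).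

Lemma pseq_compE j k m (le_jk : j <= k) (e : m + j = k) (x : M j) :
  pseq_comp le_jk x = ecast i (M i) e (pseq_shift m x).
Proof.
have em : k - j = m by rewrite -e addnK.
rewrite /pseq_comp; move: (subnK le_jk); rewrite em => e'.
by rewrite (eq_irrelevance e e').
Qed.

Lemma pseq_comp_id j (le_jj : j <= j) (x : M j) : pseq_comp le_jj x = x.
Proof. exact: (@pseq_compE j j 0 le_jj (erefl j)). Qed.

Lemma pseq_compS j k (le_jk : j <= k) (le_jk1 : j <= k.+1) (x : M j) :
  pseq_comp le_jk1 x = pseq_map M (pseq_comp le_jk x).
Proof.
move: (le_jk) (le_jk1) (subnK le_jk) => h1 h2.
move: (k - j) => m e; case: k / e le_jk le_jk1 h1 h2 => _ _ h1 h2.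
rewrite (@pseq_compE j (m + j) m h1 (erefl _)).
by rewrite (@pseq_compE j (m + j).+1 m.+1 h2 (erefl _)).
Qed.

Lemma pseq_comp_trans i j k (le_ij : i <= j) (le_jk : j <= k) (le_ik : i <= k)
    (x : M i) : pseq_comp le_ik x = pseq_comp le_jk (pseq_comp le_ij x).
Proof.
elim: k => [|k IHk] in le_jk le_ik *.
  have j0 : j = 0 by apply/eqP; rewrite -leqn0.
  move: le_ij le_jk; rewrite j0 => le_ij le_jk.
  by rewrite pseq_comp_id (bool_irrelevance le_ij le_ik).
have [le_jk' | lt_kj] := leqP j k.
  have le_ik' := leq_trans le_ij le_jk'.
  by rewrite !(@pseq_compS _ k) (IHk le_jk').
have ej : j = k.+1 by apply/eqP; rewrite eqn_leq le_jk.
move: {IHk lt_kj} le_ij le_jk; rewrite ej => le_ij le_jk.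
by rewrite pseq_comp_id (bool_irrelevance le_ij le_ik).
Qed.

Lemma pseq_comp_mono j k (le_jk : j <= k) :
  {homo pseq_comp le_jk : x y / (x <= y)%O}.
Proof.
move=> x y le_xy; rewrite /pseq_comp; move: (subnK le_jk).
move: (k - j) => m; case: k / {le_jk}.
by elim: m => //= m IHm; apply: pseq_mono.
Qed.

Definition stack_type n : Type := {j : 'I_n.+1 & M j}.

HB.instance Definition _ n := Finite.copy (stack_type n) {j : 'I_n.+1 & M j}.

(* The branch on idP makes the proof of j <= k available to the composite; see *)
(* stack_leP.                                                                  *)
Definition stack_le n (u v : stack_type n) : bool :=
  if @idP (tag u <= tag v) is ReflectT le_uv
  then (pseq_comp le_uv (tagged u) <= tagged v)%O else false.

Lemma stack_leP n (u v : stack_type n) :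
  reflect (exists le_uv : tag u <= tag v,
             (pseq_comp le_uv (tagged u) <= tagged v)%O)
          (stack_le u v).
Proof.
rewrite /stack_le; case: {-}_ / idP => [h | nh]; last by right; case.
apply: (iffP idP) => [le_xy | [h']]; first by exists h.
by rewrite (bool_irrelevance h' h).
Qed.

Fact stack_le_refl n : reflexive (@stack_le n).
Proof.
by move=> u; apply/stack_leP; exists (leqnn _); rewrite pseq_comp_id.
Qed.

Fact stack_le_anti n : antisymmetric (@stack_le n).
Proof.
move=> [j x] [k y] /andP[/stack_leP[/= h le_xy] /stack_leP[/= h' le_yx]].
have ejk : j = k by apply/val_inj/eqP; rewrite eqn_leq h.
case: k / ejk y h h' le_xy le_yx => y h h'; rewrite !pseq_comp_id => xy yx.
by congr existT; apply/le_anti; rewrite xy.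
Qed.

Fact stack_le_trans n : transitive (@stack_le n).
Proof.
move=> [j y] [i x] [k z] /stack_leP[/= hij le_xy] /stack_leP[/= hjk le_yz].
apply/stack_leP; exists (leq_trans hij hjk) => /=.
by rewrite (pseq_comp_trans hij hjk) (le_trans _ le_yz) ?pseq_comp_mono.
Qed.

HB.instance Definition _ n := Order.Le_isPOrder.Build d (stack_type n)
  (@stack_le_refl n) (@stack_le_anti n) (@stack_le_trans n).

Definition stack_map n (u : stack_type n) : stack_type n.+1 :=
  let: existT j x := u in
  existT (fun j : 'I_n.+2 => M j) (widen_ord (leqnSn n.+1) j) x.

Fact stack_mono n : {homo @stack_map n : u v / (u <= v)%O}.
Proof. by move=> [j x] [k y] le_uv; exact: le_uv. Qed.

Definition stack : posetSeq d := PosetSeq stack_mono.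

End Stacking.

Definition stack_iter d k (M : posetSeq d) : posetSeq d := iter k (@stack d) M.

Section Cubes.

Variable r : nat.

Definition cube_map n (x : n.-tupleprod 'I_r.+1) : n.+1.-tupleprod 'I_r.+1 :=
  [tuple of ord0 :: x].

Fact cube_mono n : {homo @cube_map n : x y / (x <= y)%O}.
Proof.
move=> x y; rewrite !leEtprod => /forallP le_xy; apply/forallP=> i.
by case: (unliftP ord0 i) => [j|] ->; rewrite ?tnth0 ?tnthS.
Qed.

(* C_r^0 -> C_r^1 -> ..., where C_r is 'I_r.+1 *)
Definition cube_seq : posetSeq _ := PosetSeq cube_mono.

End Cubes.

Section MaximalChains.

Variables (d : Order.disp_t) (P : finPOrderType d).

Definition is_chain (A : {set P}) : bool :=
  [forall x in A, forall y in A, (x >=< y)%O].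

Definition max_chain : Type := {A : {set P} | maxset is_chain A}.

End MaximalChains.

(* The letter a_(i+1) is i : 'I_n. *)
Section Words.

Variables k n : nat.

Definition prefix_cond (z : seq 'I_n) : bool :=
  [forall i, (i \notin z) ||
     [forall (j : 'I_n | i < j), count_mem j z <= count_mem i z]].

Definition word_cond (w : seq 'I_n) : bool :=
  [forall i, count_mem i w == k.+1] &&
  [forall m : 'I_(size w).+1, prefix_cond (take m w)].

Definition good_word : Type := {w : (k.+1 * n).-tuple 'I_n | word_cond w}.

Lemma word_condP (w : seq 'I_n) :
  reflect
    ((forall i, count_mem i w = k.+1) /\
     (forall z, prefix z w -> forall i : 'I_n,
        i \notin z \/
        forall j : 'I_n, i < j -> count_mem j z <= count_mem i z))
    (word_cond w).
Proof.
apply: (iffP andP) => [[/forallP hc /forallP hp] | [hc hp]].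
  split=> [i | z pz i]; first exact/eqP.
  have lt_z : size z < (size w).+1 by rewrite ltnS size_prefix.
  have := forallP (hp (Ordinal lt_z)) i.
  have -> : take (Ordinal lt_z) w = z by apply/eqP; rewrite -prefixE.
  by case/orP=> [|/forall_inP]; [left | right].
split; first by apply/forallP=> i; apply/eqP.
apply/forallP=> m; apply/forallP=> i; apply/orP.
have pm : prefix (take m w) w by apply: prefix_take.
by have [|h] := hp _ pm i; [left | right; apply/forall_inP].
Qed.

End Words.

(* Main.v *)
Require Import Defs.
From mathcomp Require Import all_boot all_order.
From mathcomp Require Import zify.

Set Implicit Arguments.
Unset Strict Implicit.
Unset Printing Implicit Defensive.

Import Order.TTheory.

(** An element of the [k]-iterated stacking of the cubes [C_r^n] is a vector [x]
    together with indices [j_1 <= ... <= j_k <= n], where [x] has length [j_1].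
    Counting coordinates from the right, so that padding with zeros on the left
    is invisible, record for each position [t] the height
    [b t = x_t + #{m | t < j_m}].  This identifies the poset with the set of
    functions [b <= k + r] such that [min(b, k)] is nonincreasing, ordered
    pointwise.  In that poset every covering relation changes one value of [b]
    by one, so reading a maximal chain from the top down spells a word in which
    every position occurs [k + r] times.  For [r = 1], the condition on prefixes
    says exactly that all the functions met along the way are admissible. *)

Section Content.

Variable I : finType.
Implicit Types (w : seq I) (i : I).

Definition content w : {ffun I -> nat} := [ffun i => count_mem i w].

Lemma content_cons a w i : content (a :: w) i = (a == i) + content w i.
Proof. by rewrite !ffunE. Qed.

Lemma sum_content w : \sum_i content w i = size w.
Proof.
elim: w => [|a w IHw]; first by rewrite big1 // => i _; rewrite ffunE.
under eq_bigr do rewrite content_cons.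
rewrite big_split /= IHw (bigD1 a) //= eqxx big1 // => i.
by rewrite eq_sym => /negPf->.
Qed.

Lemma content_gt0 w i : (0 < content w i) = (i \in w).
Proof. by rewrite ffunE -has_count has_pred1. Qed.

Lemma content_take_drop m w i :
  content (take m w) i + content (drop m w) i = content w i.
Proof. by rewrite !ffunE -count_cat cat_take_drop. Qed.

Lemma leq_content_drop w i :
  {homo (fun m => content (drop m w) i) : m m' /~ m <= m'}.
Proof.
move=> m' m le_m; rewrite !ffunE -(subnK le_m) -drop_drop.
by rewrite leq_count_subseq ?drop_subseq.
Qed.

Lemma content_drop_inj w w' :
  (forall m, content (drop m w) = content (drop m w')) -> w = w'.
Proof.
elim: w w' => [|a w IHw] [|b w'] // eq_ww'.
- by have /ffunP/(_ b) := eq_ww' 0; rewrite !ffunE /= eqxx.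
- by have /ffunP/(_ a) := eq_ww' 0; rewrite !ffunE /= eqxx.
have eq_w : w = w' by apply: IHw => m; apply: (eq_ww' m.+1).
have /ffunP/(_ a) := eq_ww' 0; rewrite !ffunE /= eqxx eq_w.
by case: (b =P a) => [->//|_]; lia.
Qed.

End Content.

Section MaximalChainsOfPosets.

Variables (d : Order.disp_t) (P : finPOrderType d).
Implicit Types (A : {set P}) (x y z : P).

Definition covby x y : Prop := (x < y)%O /\ forall z, ~~ (x < z < y)%O.

Lemma is_chainP A : reflect {in A &, forall x y, (x >=< y)%O} (is_chain A).
Proof.
apply: (iffP forall_inP) => [chA x y xA yA | chA x xA].
  exact: (forall_inP (chA x xA)).
by apply/forall_inP => y yA; apply: chA.
Qed.

Lemma max_chainP A :
  reflect ({in A &, forall x y, (x >=< y)%O} /\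
           forall y, {in A, forall x, (y >=< x)%O} -> y \in A)
          (maxset (@is_chain d P) A).
Proof.
apply: (iffP maxsetP) => [[/is_chainP chA maxA]|[chA maxA]].
  split=> // y cmp_y; rewrite -(maxA (y |: A)) ?setU11 ?subsetUr //.
  apply/is_chainP => a b /setU1P[->|aA] /setU1P[->|bA].
  - exact: comparablexx.
  - exact: cmp_y.
  - by rewrite comparable_sym; apply: cmp_y.
  - exact: chA.
split=> [|B /is_chainP chB sAB]; first exact/is_chainP.
apply/eqP; rewrite eqEsubset sAB andbT; apply/subsetP => y yB.
by apply: maxA => x xA; apply: chB => //; apply: (subsetP sAB).
Qed.

Lemma proper_down_set x y :
  (x < y)%O -> [set z | (z <= x)%O] \proper [set z | (z <= y)%O].
Proof.
move=> lt_xy; apply/properP; split.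
  by apply/subsetP => z; rewrite !inE => /le_trans-> //; apply: ltW.
by exists y; rewrite !inE ?lexx // lt_geF.
Qed.

Lemma max_chain_covby A x y : maxset (@is_chain d P) A ->
  x \in A -> y \in A -> (y < x)%O -> exists2 z, z \in A & covby z x.
Proof.
move=> /max_chainP[chA maxA] xA yA lt_yx.
have yAx : (y \in A) && (y < x)%O by rewrite yA.
case: (@arg_maxnP _ y (fun z => (z \in A) && (z < x)%O)
         (fun z => #|[set u | (u <= z)%O]|) yAx) => z /andP[zA lt_zx] max_z.
have le_z a : a \in A -> (a < x)%O -> (a <= z)%O.
  move=> aA lt_ax; case/orP: (chA a z aA zA) => //.
  rewrite le_eqVlt => /predU1P[->//|/proper_down_set/proper_card lt_card].
  by have /= := max_z a; rewrite aA lt_ax leqNgt lt_card => /(_ isT).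
exists z => //; split=> // u; apply/negP => /andP[lt_zu lt_ux].
suff uA : u \in A by have := le_z u uA lt_ux; rewrite lt_geF.
apply: maxA => a aA; case/orP: (chA x a xA aA) => [le_xa|].
  by rewrite /Order.comparable (le_trans (ltW lt_ux) le_xa).
rewrite le_eqVlt => /predU1P[->|lt_ax]; first exact: lt_comparable.
by apply: ge_comparable; apply: le_trans (le_z a aA lt_ax) (ltW lt_zu).
Qed.

End MaximalChainsOfPosets.

Section DescendingWords.

Variables (I : finType) (d : Order.disp_t) (P : finPOrderType d).
Variable h : P -> {ffun I -> nat}.
Hypothesis h_le : forall x y, (x <= y)%O <-> forall i, h x i <= h y i.
Hypothesis h_covby :
  forall x y, covby x y -> exists i, forall j, h y j = (i == j) + h x j.
Variables bot top : P.
Hypothesis h_bot : h bot = [ffun=> 0].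
Hypothesis le_top : forall x, (x <= top)%O.
Implicit Types (w : seq I) (x y : P).

Definition rank x := \sum_i h x i.

Lemma rank_le x y : (x <= y)%O -> rank x <= rank y.
Proof. by move/h_le => le_xy; apply: leq_sum. Qed.

Lemma rank_lt x y : (x < y)%O -> rank x < rank y.
Proof.
move=> lt_xy; have /h_le le_xy := ltW lt_xy.
rewrite (ltn_leqif (leqif_sum (fun i _ => leqif_eq (le_xy i)))).
apply: contraTN lt_xy => /forallP eq_xy; rewrite le_gtF //.
by apply/h_le => i; rewrite (eqP (eq_xy i)).
Qed.

Lemma comparable_rank_inj x y : (x >=< y)%O -> rank x = rank y -> x = y.
Proof.
by case/comparable_ltgtP => // /rank_lt lt_rank eq_rank;
  rewrite eq_rank ltnn in lt_rank.
Qed.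

Definition word_chain w : {set P} :=
  [set x | [exists m : 'I_(size w).+1, h x == content (drop m w)]].

Lemma word_chainP w x :
  reflect (exists m, h x = content (drop m w)) (x \in word_chain w).
Proof.
rewrite inE; apply: (iffP existsP) => [[m /eqP]|[m hx]]; first by exists m.
have lt_m : minn m (size w) < (size w).+1 by rewrite ltnS geq_minr.
exists (Ordinal lt_m); apply/eqP; rewrite hx /=.
by case: leqP => // /ltnW le_wm; rewrite !drop_oversize.
Qed.

Lemma rank_word_chain w m x :
  h x = content (drop m w) -> rank x = size w - m.
Proof. by rewrite /rank => ->; rewrite sum_content size_drop. Qed.

Definition descending_word w : Prop :=
  content w = h top /\ forall m, content (drop m w) \in codom h.

Lemma size_descending_word w : descending_word w -> size w = rank top.
Proof. by case=> w_top _; rewrite /rank -w_top sum_content. Qed.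

Lemma word_chain_chain w : is_chain (word_chain w).
Proof.
apply/is_chainP => x y /word_chainP[m hx] /word_chainP[m' hy].
by have [le_m|/ltnW le_m] := leqP m m'; apply/orP; [right|left];
  apply/h_le => i; rewrite hx hy; apply: leq_content_drop.
Qed.

(* The chain has an element of each rank, and two comparable elements of the
   same rank are equal. *)
Lemma word_chain_max w :
  descending_word w -> maxset (@is_chain d P) (word_chain w).
Proof.
move=> dw; apply/max_chainP; split; first exact/is_chainP/word_chain_chain.
move=> y cmp_y; have /codomP[x hx] := dw.2 (size w - rank y).
have x_w : x \in word_chain w by apply/word_chainP; eexists; apply/esym/hx.
rewrite (comparable_rank_inj (cmp_y x x_w)) //.
rewrite (rank_word_chain (esym hx)) subKn // size_descending_word //.
exact/rank_le/le_top.
Qed.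

Lemma word_chain_inj w w' :
  descending_word w -> descending_word w' -> word_chain w = word_chain w' ->
  w = w'.
Proof.
move=> dw dw' eq_ch; apply: content_drop_inj => m.
have eq_size : size w = size w' by rewrite !size_descending_word.
have /codomP[x hx] := dw.2 m.
have /word_chainP[m' hx'] : x \in word_chain w'.
  by rewrite -eq_ch; apply/word_chainP; exists m.
have := rank_word_chain hx'; rewrite (rank_word_chain (esym hx)) eq_size hx hx'.
have [lt_m eq_m|ge_m eq_m] := ltnP m (size w').
  by congr (content (drop _ _)); lia.
by rewrite !drop_oversize //; lia.
Qed.

Lemma max_chain_suffixes A x : maxset (@is_chain d P) A -> x \in A ->
  exists2 w, content w = h x &
    forall m, exists2 y, y \in A & h y = content (drop m w).
Proof.
move=> maxA; have [_ A_max] := max_chainP _ maxA.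
have botA : bot \in A.
  apply: A_max => a _; apply: le_comparable.
  by apply/h_le => i; rewrite h_bot ffunE.
have [r] := ubnP (rank x); elim: r => // r IHr in x * => lt_xr xA.
have [->|ne_x] := eqVneq x bot.
  have eq_bot : h bot = content [::] by apply/ffunP => i; rewrite h_bot !ffunE.
  by exists [::] => // m; exists bot.
have lt_bot : (bot < x)%O.
  by rewrite lt_neqAle eq_sym ne_x; apply/h_le => i; rewrite h_bot ffunE.
have [z zA cov_zx] := max_chain_covby maxA xA botA lt_bot.
have lt_zr : rank z < r by apply: leq_trans (rank_lt cov_zx.1) _.
have [i hx] := h_covby cov_zx; have [w hz wA] := IHr z lt_zr zA.
have eq_x : content (i :: w) = h x.
  by apply/ffunP => j; rewrite content_cons hx hz.
by exists (i :: w) => // - [|m]; [exists x | apply: wA].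
Qed.

Lemma max_chain_word A : maxset (@is_chain d P) A ->
  exists2 w, descending_word w & word_chain w = A.
Proof.
move=> maxA; have [_ A_max] := max_chainP _ maxA.
have topA : top \in A by apply: A_max => a _; apply: ge_comparable.
have [w w_top wA] := max_chain_suffixes maxA topA.
have dw : descending_word w.
  by split=> // m; have [y _ <-] := wA m; apply: codom_f.
exists w => //; have [_ w_max] := maxsetP (word_chain_max dw).
apply/esym/w_max; first exact: (maxsetp maxA).
apply/subsetP => x /word_chainP[m hx]; have [y yA hy] := wA m.
suff -> : x = y by [].
by apply/le_anti/andP; split; apply/h_le => i; rewrite hx hy.
Qed.

Lemma max_chain_descending_word_bij N (W : pred (seq I)) :
  (forall w, W w <-> descending_word w) -> N = rank top ->
  exists f : max_chain P -> {w : N.-tuple I | W w}, bijective f.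
Proof.
move=> W_desc N_top.
have W_max (u : {w : N.-tuple I | W w}) :
    maxset (@is_chain d P) (word_chain (val u)).
  exact/word_chain_max/W_desc/(valP u).
have chain_word (A : max_chain P) :
    exists u : {w : N.-tuple I | W w}, word_chain (val u) == val A.
  have [w dw <-] := max_chain_word (valP A).
  have size_w : size w == N by rewrite N_top (size_descending_word dw).
  have Ww : W (Tuple size_w) by apply/W_desc.
  by exists (exist _ (Tuple size_w) Ww).
exists (fun A => xchoose (chain_word A)).
exists (fun u : {w : N.-tuple I | W w} =>
          exist _ (word_chain (val u)) (W_max u)) => [A|u].
  exact/val_inj/eqP/(xchooseP (chain_word A)).
set A := exist _ _ _; apply/val_inj/val_inj/word_chain_inj.
- exact/W_desc/(valP (xchoose (chain_word A))).
- exact/W_desc/(valP u).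
exact/eqP/(xchooseP (chain_word A)).
Qed.

End DescendingWords.

Section Padding.

Variable n : nat.
Implicit Types (b : {ffun 'I_n -> nat}) (f g : nat -> nat) (i : 'I_n).

(* Positions are counted from the right: letter [i] is position [n - 1 - i]. *)
Definition pad b t : nat := if insub t is Some i then b (rev_ord i) else 0.

Definition unpad f : {ffun 'I_n -> nat} := [ffun i => f (rev_ord i)].

Lemma pad_rev_ord b i : pad b (rev_ord i) = b i.
Proof. by rewrite /pad valK rev_ordK. Qed.

Lemma pad_out b t : n <= t -> pad b t = 0.
Proof. by move=> le_nt; rewrite /pad insubF // ltnNge le_nt. Qed.

Lemma forall_rev_ord (Q : nat -> Prop) :
  (forall t, n <= t -> Q t) -> (forall i, Q (rev_ord i)) -> forall t, Q t.
Proof.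
move=> Q_out Q_rev t; have [lt_tn|/Q_out//] := ltnP t n.
by have := Q_rev (rev_ord (Ordinal lt_tn)); rewrite rev_ordK.
Qed.

Lemma unpad_eq f b :
  (forall t, n <= t -> f t = 0) -> unpad f = b <-> f =1 pad b.
Proof.
move=> f_out; split=> [<- | eq_f]; last first.
  by apply/ffunP => i; rewrite ffunE eq_f pad_rev_ord.
by apply: forall_rev_ord => [t le_nt|i];
  rewrite ?pad_rev_ord ?ffunE // f_out ?pad_out.
Qed.

Lemma unpad_le f g : (forall t, n <= t -> f t = 0) ->
  (forall i, unpad f i <= unpad g i) <-> forall t, f t <= g t.
Proof.
move=> f_out; split=> [le_fg | le_fg i]; last by rewrite !ffunE.
apply: forall_rev_ord => [t le_nt|i]; first by rewrite f_out.
by have := le_fg i; rewrite !ffunE.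
Qed.

End Padding.

Record height_axioms d (M : posetSeq d) (h : forall n, M n -> nat -> nat) :
    Prop := {
  height_out : forall n (x : M n) t, n <= t -> h n x t = 0;
  height_map : forall n (x : M n), h n.+1 (pseq_map M x) =1 h n x;
  height_le : forall n (x y : M n),
    (x <= y)%O <-> forall t, h n x t <= h n y t }.

Section StackHeight.

Variables (d : Order.disp_t) (M : posetSeq d) (h : forall n, M n -> nat -> nat).
Arguments h {n}.

Definition stack_height n (u : stack M n) t : nat :=
  (t < tag u) + h (tagged u) t.

Hypothesis hM : height_axioms (@h).

Lemma height_pseq_comp m n (le_mn : m <= n) (x : M m) :
  h (pseq_comp le_mn x) =1 h x.
Proof.
move=> t; rewrite /pseq_comp; move: (subnK le_mn); move: (n - m) => p.
case: n / {le_mn} => /=.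
by elim: p => //= p IHp; rewrite (height_map hM).
Qed.

Lemma stack_height_le n (u v : stack M n) :
  (u <= v)%O <-> forall t, stack_height u t <= stack_height v t.
Proof.
case: u v => [j x] [l y]; rewrite [(_ <= _)%O]/(stack_le _ _).
split=> [/stack_leP[/= le_jl /(height_le hM) le_xy] t|le_xy].
  by have := le_xy t; rewrite height_pseq_comp /stack_height /=; lia.
rewrite /stack_height /= in le_xy.
have le_jl : j <= l.
  rewrite leqNgt; apply/negP => lt_lj; have := le_xy l.
  by rewrite lt_lj ltnn (height_out hM y).
apply/stack_leP; exists le_jl; apply/(height_le hM) => t /=.
rewrite height_pseq_comp; have [lt_tj|le_jt] := ltnP t j; last first.
  by rewrite (height_out hM x).
by have := le_xy t; rewrite lt_tj (leq_trans lt_tj le_jl) ltnS.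
Qed.

Lemma stack_height_axioms : height_axioms stack_height.
Proof.
split=> [n [j x] t le_nt|n [j x] t|] //; last exact: stack_height_le.
by have := ltn_ord j => lt_j; rewrite /stack_height /= (height_out hM x); lia.
Qed.

Lemma stack_height_range n (b : nat -> nat) :
  (exists u : stack M n, stack_height u =1 b) <->
  exists j, [/\ j <= n, forall t, (0 < b t) = (t < j) &
                exists x : M j, h x =1 predn \o b].
Proof.
split=> [[[j x] eq_b]|[j [le_jn b_gt0 [x hx]]]].
  have b_def t : b t = (t < j) + h x t by rewrite -eq_b.
  have h_gt0 t : 0 < h x t -> t < j.
    by rewrite [t < j]ltnNge; apply: contraTN => /(height_out hM x)->.
  exists j; split=> [|t|]; first by rewrite -ltnS.
    by rewrite b_def; have := h_gt0 t; lia.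
  by exists x => t /=; rewrite b_def; have := h_gt0 t; lia.
exists (existT (fun i : 'I_n.+1 => M i) (Ordinal (le_jn : j < n.+1)) x).
by move=> t; rewrite /stack_height /= hx -b_gt0 /=; lia.
Qed.

End StackHeight.

Section CubeHeight.

Variable r : nat.

Definition cube_height n (x : cube_seq r n) : nat -> nat :=
  pad [ffun i => tnth (x : n.-tuple 'I_r.+1) i : nat].

Lemma cube_height_rev_ord n (x : cube_seq r n) (i : 'I_n) :
  cube_height x (rev_ord i) = tnth (x : n.-tuple 'I_r.+1) i.
Proof. by rewrite /cube_height pad_rev_ord ffunE. Qed.

Lemma cube_height_axioms : height_axioms cube_height.
Proof.
split=> [n x t|n x|n x y]; first exact: pad_out.
  apply: (@forall_rev_ord n.+1) => [t lt_nt|i].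
    by rewrite /cube_height !pad_out // ltnW.
  rewrite cube_height_rev_ord; case: (unliftP ord0 i) => [j|] ->.
    by rewrite tnthS -cube_height_rev_ord /= /bump /=; congr cube_height; lia.
  by rewrite tnth0 /cube_height pad_out //=; lia.
rewrite leEtprod; split=> [/forallP le_xy|le_xy].
  apply: (@forall_rev_ord n) => [t le_nt|i].
    by rewrite /cube_height !pad_out.
  by rewrite !cube_height_rev_ord; apply: le_xy.
by apply/forallP => i; have := le_xy (rev_ord i); rewrite !cube_height_rev_ord.
Qed.

End CubeHeight.

Section IteratedStackHeight.

Definition is_height k c n (b : nat -> nat) : Prop :=
  [/\ forall t, b t <= c, forall t, n <= t -> b t = 0
    & {homo (fun t => minn (b t) k) : s t /~ s <= t}].

Lemma is_heightS k c n b : is_height k.+1 c.+1 n b <->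
  exists j, [/\ j <= n, forall t, (0 < b t) = (t < j)
                & is_height k c j (predn \o b)].
Proof.
split=> [[b_le b_out b_mono]|[j [le_jn b_gt0 [b_le b_out b_mono]]]]; last first.
  split=> [t|t le_nt|s t le_st]; first by have := b_le t => /=; lia.
    by have := b_gt0 t; lia.
  by have := b_mono s t le_st; have := b_gt0 s; have := b_gt0 t => /=; lia.
have b_zero : exists t, b t == 0 by exists n; rewrite b_out.
case: (ex_minnP b_zero) => j /eqP bj0 min_j.
have b_gt0 t : (0 < b t) = (t < j).
  have [lt_tj|le_jt] := ltnP t j.
    by rewrite lt0n; apply: contraL lt_tj => /min_j; rewrite -leqNgt.
  by have := b_mono _ _ le_jt; rewrite bj0; lia.
exists j; split=> //; first by apply: min_j; rewrite b_out.
split=> [t|t le_jt|s t le_st] /=; first by have := b_le t; lia.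
  by have := b_gt0 t; lia.
by have := b_mono s t le_st; lia.
Qed.

Variable r : nat.

Fixpoint height k : forall n, stack_iter k (cube_seq r) n -> nat -> nat :=
  match k return forall n, stack_iter k (cube_seq r) n -> nat -> nat with
  | 0 => @cube_height r
  | k'.+1 => stack_height (@height k')
  end.

Lemma height_axiomsP k : height_axioms (@height k).
Proof.
elim: k => [|k IHk]; [exact: cube_height_axioms | exact: stack_height_axioms].
Qed.

Lemma cube_height_range n b :
  (exists x : cube_seq r n, cube_height x =1 b) <-> is_height 0 r n b.
Proof.
split=> [[x eq_b]|[b_le b_out _]].
  split=> [t|t le_nt|s t _]; last by rewrite !minn0.
    elim/(@forall_rev_ord n): t => [t le_nt|i]; rewrite -eq_b.
      by rewrite /cube_height pad_out.
    by rewrite cube_height_rev_ord -ltnS.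
  by rewrite -eq_b /cube_height pad_out.
exists [tuple inord (b (rev_ord i)) | i < n] => t.
elim/(@forall_rev_ord n): t => [t le_nt|i].
  by rewrite b_out // /cube_height pad_out.
by rewrite cube_height_rev_ord tnth_mktuple inordK // ltnS.
Qed.

Lemma height_range k n b :
  (exists x : stack_iter k (cube_seq r) n, height x =1 b) <->
  is_height k (k + r) n b.
Proof.
elim: k n b => [|k IHk] n b; first exact: cube_height_range.
rewrite addSn is_heightS (stack_height_range (height_axiomsP k)).
by split=> -[j [le_jn b_gt0 /IHk]]; exists j.
Qed.

End IteratedStackHeight.

Section Profiles.

Variable n : nat.
Implicit Type b : {ffun 'I_n -> nat}.

Definition is_profile k c b : Prop :=
  (forall i, b i <= c) /\ {homo (fun i => minn (b i) k) : i j / i <= j}.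

Lemma is_height_pad k c b : is_height k c n (pad b) <-> is_profile k c b.
Proof.
split=> [[b_le _ b_mono]|[b_le b_mono]].
  split=> [i|i j le_ij]; rewrite -!pad_rev_ord; first exact: b_le.
  by apply: b_mono => /=; lia.
split=> [|t|].
- by apply: (@forall_rev_ord n) => [t /pad_out->|i]; rewrite ?pad_rev_ord.
- exact: pad_out.
move=> s t; elim/(@forall_rev_ord n): s => [s le_ns|i].
  by rewrite (pad_out _ le_ns) min0n.
elim/(@forall_rev_ord n): t => [t le_nt|j] le_ij.
  by have := ltn_ord (rev_ord i); lia.
rewrite !pad_rev_ord; apply: b_mono.
by have := ltn_ord i; have := ltn_ord j; move: le_ij => /=; lia.
Qed.

Lemma is_profile_decrement k c b b' :
  is_profile k c b -> is_profile k c b' -> (forall i, b i <= b' i) ->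
  (exists i, b i < b' i) ->
  exists2 i, b i < b' i & is_profile k c [ffun j => b' j - (i == j)].
Proof.
move=> [_ b_mono] [b'_le b'_mono] le_bb' [i0 lt_i0].
have decrement (i : 'I_n) :
    (forall j : 'I_n, j < i -> minn (b' j) k <= minn (b' i - 1) k) ->
    is_profile k c [ffun j => b' j - (i == j)].
  move=> b'_i; split=> [j|j l le_jl]; rewrite !ffunE.
    by rewrite (leq_trans (leq_subr _ _)).
  have := b'_mono j l le_jl; case: (i =P l) le_jl => [<-|_] le_jl; last lia.
  have [<-//|ne_ij] := eqVneq i j.
  by have := b'_i j; move: ne_ij; rewrite -val_eqE /=; lia.
(* Decreasing a value above [k] leaves [min(b', k)] unchanged. If no value to be
   decreased is above [k], decrease the one of the first letter. *)
case: (pickP (fun i => (b i < b' i) && (k < b' i))) => [i|no_gt].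
  case/andP=> lt_i gt_k.
  by exists i => //; apply: decrement => j lt_ji; have := b'_mono j i; lia.
case: (@arg_minnP _ i0 (fun i => b i < b' i) val lt_i0) => /= i lt_i min_i.
exists i => //; apply: decrement => j lt_ji.
have := b_mono j i; have := min_i j; have := le_bb' j; have := no_gt i.
by rewrite lt_i /=; lia.
Qed.

End Profiles.

Section StackedCubes.

Variables k r n : nat.
Implicit Types x y : stack_iter k (cube_seq r) n.

Definition profile x : {ffun 'I_n -> nat} := unpad n (height x).

Lemma profile_le x y : (x <= y)%O <-> forall i, profile x i <= profile y i.
Proof.
rewrite (height_le (height_axiomsP r k)) unpad_le //.
exact: height_out (height_axiomsP r k) _ _.
Qed.

Lemma profile_codomP b : b \in codom profile <-> is_profile k (k + r) b.
Proof.
have profileE x : profile x = b <-> height x =1 pad b.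
  by apply: unpad_eq; apply: height_out (height_axiomsP r k) _ _.
rewrite -is_height_pad -height_range.
split=> [/codomP[x /esym/profileE]|[x /profileE <-]]; first by exists x.
exact: codom_f.
Qed.

Lemma profile_covby x y : covby x y ->
  exists i, forall j, profile y j = (i == j) + profile x j.
Proof.
case=> lt_xy no_between; have /profile_le le_xy := ltW lt_xy.
have is_profile_profile z : is_profile k (k + r) (profile z).
  exact/profile_codomP/codom_f.
have [|i lt_i] := is_profile_decrement (is_profile_profile x)
  (is_profile_profile y) le_xy.
  apply/existsP; apply: contraTT lt_xy => /existsPn ge_xy.
  by rewrite le_gtF //; apply/profile_le => i; rewrite leqNgt.
move=> /profile_codomP/codomP[z /ffunP eq_z].
have z_def j : profile z j = profile y j - (i == j) by rewrite -eq_z ffunE.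
have le_xz : (x <= z)%O.
  apply/profile_le => j; have := le_xy j; rewrite z_def.
  by case: (i =P j) lt_i => [<-|]; lia.
have lt_zy : (z < y)%O.
  rewrite lt_leAnge; apply/andP; split.
    by apply/profile_le => j; rewrite z_def leq_subr.
  by apply/negP => /profile_le/(_ i); rewrite z_def eqxx; lia.
have eq_xz : x = z.
  apply/eqP; move: (no_between z).
  by rewrite lt_zy andbT lt_neqAle le_xz andbT negbK.
exists i => j; rewrite eq_xz z_def.
by case: (i =P j) lt_i => [<-|]; lia.
Qed.

Lemma max_chain_stacked_cubes_bij N (W : pred (seq 'I_n)) :
  (forall w, W w <-> content w = [ffun=> k + r] /\
     forall m, is_profile k (k + r) (content (drop m w))) ->
  N = (k + r) * n ->
  exists f : max_chain (stack_iter k (cube_seq r) n) ->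
             {w : N.-tuple 'I_n | W w}, bijective f.
Proof.
move=> W_profile ->.
have const_profile c : c <= k + r -> exists x, profile x = [ffun=> c].
  move=> le_c; suff /codomP[x ->] : [ffun=> c] \in codom profile by exists x.
  by apply/profile_codomP; split=> [i|i j _]; rewrite !ffunE.
have [bot profile_bot] := const_profile 0 isT.
have [top profile_top] := const_profile (k + r) (leqnn _).
apply: (max_chain_descending_word_bij profile_le profile_covby profile_bot
          (top := top)).
- move=> x; apply/profile_le => i; rewrite profile_top [leqRHS]ffunE.
  by have /profile_codomP[+ _] := codom_f profile x; apply.
- move=> w; rewrite W_profile /descending_word profile_top.
  by split=> -[w_top w_suff]; split=> // m; apply/profile_codomP.
rewrite /rank profile_top; under eq_bigr do rewrite ffunE.
by rewrite sum_nat_const card_ord mulnC.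
Qed.

End StackedCubes.

Section PrefixConditions.

Variable n : nat.
Implicit Type w : seq 'I_n.

Lemma is_profile_content_drop k r w : content w = [ffun=> k + r] ->
  (forall m, is_profile k (k + r) (content (drop m w))) <->
  (forall m, {homo (fun i => content (take m w) i - r) : i j /~ i <= j}).
Proof.
move=> /ffunP count_w.
have take_drop m i : content (take m w) i + content (drop m w) i = k + r.
  by rewrite content_take_drop count_w ffunE.
split=> [w_profile m j i le_ij|w_mono m].
  have [_ /(_ i j le_ij)] := w_profile m.
  by have := take_drop m i; have := take_drop m j => /=; lia.
split=> [i|i j le_ij]; first by rewrite -(take_drop m i) leq_addl.
have := w_mono m j i le_ij; have := take_drop m i; have := take_drop m j => /=.
by lia.
Qed.

Lemma prefix_condP w :
  reflect (forall i j : 'I_n, i \in w -> i < j -> content w j <= content w i)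
          (prefix_cond w).
Proof.
apply: (iffP forallP) => [w_cond i j i_w lt_ij|le_content i].
  by have := w_cond i; rewrite i_w !ffunE => /forall_inP->.
have [i_w|//] := boolP (i \in w); apply/forall_inP => j lt_ij.
by have := le_content i j i_w lt_ij; rewrite !ffunE.
Qed.

(* If [i] does not occur in [take m w] yet, the condition at its first later
   occurrence bounds the number of [j]s there by one. *)
Lemma prefix_cond_homo w : (forall i, i \in w) ->
  (forall m, prefix_cond (take m w)) <->
  (forall m, {homo (fun i => content (take m w) i - 1) : i j /~ i <= j}).
Proof.
move=> w_all; split=> [w_cond m j i|w_mono m]; last first.
  apply/prefix_condP => i j; rewrite -content_gt0 => i_m /ltnW le_ij.
  by have := w_mono m j i le_ij; rewrite leq_sub2rE.
rewrite leq_eqVlt => /predU1P[/val_inj->//|lt_ij].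
have leq_content m' : i \in take m' w ->
    content (take m' w) j <= content (take m' w) i.
  by move=> i_m'; apply: (prefix_condP _ (w_cond m')).
have [/leq_content|i_m] := boolP (i \in take m w); first exact: leq_sub2r.
set p := index i w.
have lt_p : p < size w by rewrite index_mem.
have le_mp : m <= p by rewrite leqNgt -in_take.
have content_i : content (take p.+1 w) i = 1.
  rewrite ffunE (take_nth i) // nth_index // -cats1 count_cat /= eqxx.
  by have /count_memPn-> : i \notin take p w by rewrite in_take // ltnn.
have le_j : content (take m w) j <= content (take p.+1 w) j.
  rewrite !ffunE -(@take_takel _ m p.+1 w) ?leqW //.
  by rewrite leq_count_subseq ?take_subseq.
by have := leq_content p.+1; rewrite -content_gt0 content_i => /(_ isT); lia.
Qed.

Lemma word_cond_content k w : word_cond k w <->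
  content w = [ffun=> k + 1] /\ forall m, prefix_cond (take m w).
Proof.
split=> [/word_condP[count_w w_cond]|[/ffunP count_w w_cond]].
  split=> [|m]; first by apply/ffunP => i; rewrite !ffunE count_w addn1.
  apply/forallP => i; have [->//|le_i] := w_cond _ (prefix_take w m) i.
  by apply/orP; right; apply/forall_inP.
apply/andP; split; last exact/forallP.
by apply/forallP => i; have := count_w i; rewrite !ffunE addn1 => ->.
Qed.

Lemma word_cond_profile k w : word_cond k w <->
  content w = [ffun=> k + 1] /\
  forall m, is_profile k (k + 1) (content (drop m w)).
Proof.
have prefix_profile : content w = [ffun=> k + 1] ->
    (forall m, prefix_cond (take m w)) <->
    (forall m, is_profile k (k + 1) (content (drop m w))).
  move=> content_w; rewrite is_profile_content_drop // prefix_cond_homo // => i.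
  by rewrite -content_gt0 content_w ffunE addn1.
by rewrite word_cond_content; split=> -[content_w /prefix_profile w_cond];
  split=> //; apply: w_cond.
Qed.

End PrefixConditions.

Theorem theorem2p2 (k n : nat) :
  exists f : max_chain (stack_iter k (cube_seq 1) n) -> good_word k n,
    bijective f.
Proof.
by apply: max_chain_stacked_cubes_bij (@word_cond_profile n k) _; rewrite addn1.
Qed.
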